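(* Let $f\in\mathbb{R}^N$ and let $P:\mathbb{R}^N\to\mathbb{R}^N$ be a map satisfying: (1) monotonicity: for all $u,v\in\mathbb{R}^N$, $u\ge v$ implies $Pu\ge Pv$; (5) non-expansion: $\|Pu-Pv\|_\infty\le\|u-v\|_\infty$ for all $u,v\in\mathbb{R}^N$; (7) uniform connectedness: there exist $n_0\in\mathbb{N}_+$ and $\epsilon_0>0$ such that for every component $x$, every $\delta>0$ and all $u,v\in\mathbb{R}^N$ with $u\ge v+\delta\cdot 1_x$, one has $P^{n_0}u\ge P^{n_0}v+\epsilon_0\delta\cdot\overrightarrow{1}$; (8) accumulation point at infinity: there is a component $x_0\in\{1,\dots,N\}$ such that the sequence $f_n:=P^nf-P^nf(x_0)\cdot\overrightarrow{1}$ has a finite accumulation point $g\in\mathbb{R}^N$. Then $f_n\to g$ as $n\to\infty$, and the limit is unique, i.e. for any $\tilde f\in\mathbb{R}^N$ such that $\tilde f_n:=P^n\tilde f-P^n\tilde f(x_0)\cdot\overrightarrow{1}$ has a finite accumulation point, one has $\lim_{n\to\infty}\tilde f_n=g$.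
   Context: Inequalities between vectors of $\mathbb{R}^N$ are componentwise. $\overrightarrow{1}=(1,\dots,1)\in\mathbb{R}^N$; $1_x\in\mathbb{R}^N$ has $1_x(x)=1$ and $1_x(y)=0$ for $y\ne x$; $\|u\|_\infty=\max_x|u(x)|$; $P^n$ is the $n$-fold iterate of $P$. A vector $g\in\mathbb{R}^N$ is a finite accumulation point of a sequence $(h_n)$ in $\mathbb{R}^N$ if for every $n$ and every $\epsilon>0$ there is $k>n$ with $\|h_k-g\|_\infty<\epsilon$. (A map satisfying (1) and (5) is called a discrete-time nonlinear Markov chain.) *)

(* Defs.v *)
From mathcomp Require Import all_boot all_order all_algebra.
From mathcomp Require Import all_classical all_reals all_analysis.
Import Order.TTheory GRing.Theory Num.Theory.
Import numFieldNormedType.Exports.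

Set Implicit Arguments.
Unset Strict Implicit.
Unset Printing Implicit Defensive.

Local Open Scope classical_set_scope.
Local Open Scope ring_scope.

(* R^N is 'rV[R]_N.  On this type the library's norm `|u| is mx_norm, the
   maximum of the `|u 0 i| (see mx_normrE), i.e. the sup norm, and convergence
   of sequences is convergence for that norm. *)

Definition vle (R : realType) (N : nat) (u v : 'rV[R]_N) : Prop :=
  forall x : 'I_N, u 0 x <= v 0 x.

Definition vone (R : realType) (N : nat) : 'rV[R]_N := const_mx 1.

Definition vind (R : realType) (N : nat) (x : 'I_N) : 'rV[R]_N :=
  delta_mx 0 x.

Arguments vone {R N}.
Arguments vind {R N} x.

Definition monotone_map (R : realType) (N : nat)
    (P : 'rV[R]_N -> 'rV[R]_N) : Prop :=
  forall u v : 'rV[R]_N, vle v u -> vle (P v) (P u).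

Definition non_expansive (R : realType) (N : nat)
    (P : 'rV[R]_N -> 'rV[R]_N) : Prop :=
  forall u v : 'rV[R]_N, `|P u - P v| <= `|u - v|.

Definition uniformly_connected (R : realType) (N : nat)
    (P : 'rV[R]_N -> 'rV[R]_N) : Prop :=
  exists (n0 : nat) (eps0 : R), [/\ (0 < n0)%N, 0 < eps0 &
    forall (x : 'I_N) (delta : R) (u v : 'rV[R]_N), 0 < delta ->
      vle (v + delta *: vind x) u ->
      vle (iter n0 P v + (eps0 * delta) *: vone) (iter n0 P u)].

Definition accumulation_point (R : realType) (N : nat)
    (h : nat -> 'rV[R]_N) (g : 'rV[R]_N) : Prop :=
  forall (n : nat) (eps : R), 0 < eps ->
    exists2 k : nat, (n < k)%N & `|h k - g| < eps.

Definition normalized_orbit (R : realType) (N : nat)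
    (P : 'rV[R]_N -> 'rV[R]_N) (x0 : 'I_N) (f : 'rV[R]_N) (n : nat)
    : 'rV[R]_N :=
  iter n P f - (iter n P f) 0 x0 *: vone.

(* Main.v *)
(* Put D_n = P^n u - P^n v. Comparing P^n v + |D_n| 1 with P^n u through uniform
   connectedness shows that |D_n| drops by at least eps0 times the oscillation
   of D_n within n0 steps. As |D_n| is nonincreasing, the oscillations are
   summable. For arbitrary u, v this makes the normalized orbits asymptotic;
   for v = P u it makes the normalized orbit of u a Cauchy sequence. *)

Require Import Defs.
From mathcomp Require Import all_boot all_order all_algebra.
From mathcomp Require Import all_classical all_reals all_analysis.
From mathcomp Require Import lra.
Import Order.TTheory GRing.Theory Num.Theory.
Import numFieldNormedType.Exports.

Local Open Scope classical_set_scope.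
Local Open Scope ring_scope.

Section MatrixNorm.
Variables (R : realType) (N : nat).
Implicit Types u v d : 'rV[R]_N.

Lemma normr_row_le d (c : R) :
  0 <= c -> (forall x, `|d 0 x| <= c) -> `|d| <= c.
Proof.
move=> c0 dc; rewrite /Num.norm /= mx_normrE.
by apply: bigmax_le => // -[i x] _ /=; rewrite ord1.
Qed.

Lemma entry_le_normr d x : d 0 x <= `|d|.
Proof.
apply: le_trans (ler_norm _) _; rewrite [leRHS]/Num.norm /= mx_normrE.
exact: (@le_bigmax _ _ _ 0 (fun ij => `|d ij.1 ij.2|) (0, x)).
Qed.

End MatrixNorm.

Section Orbits.
Variables (R : realType) (N : nat) (P : 'rV[R]_N -> 'rV[R]_N).
Hypotheses (P_mono : monotone_map P) (P_nonexp : non_expansive P).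
Implicit Types u v : 'rV[R]_N.

Lemma iter_monotone n : monotone_map (iter n P).
Proof. by elim: n => [|n IHn] u v uv //=; apply/P_mono/IHn. Qed.

Lemma iter_non_expansive n : non_expansive (iter n P).
Proof.
by elim: n => [|n IHn] u v //=; apply: le_trans (P_nonexp _ _) (IHn _ _).
Qed.

Section Connected.
Variables (n0 : nat) (eps0 : R).
Hypotheses (n0_gt0 : (0 < n0)%N) (eps0_gt0 : 0 < eps0).
Hypothesis P_conn : forall (x : 'I_N) (delta : R) u v, 0 < delta ->
  vle (v + delta *: vind x) u ->
  vle (iter n0 P v + (eps0 * delta) *: vone) (iter n0 P u).

(** Compare both with [w], the shift of [v] by [c]. Non-expansion keeps [iter n0 P w] at most [c]
    above [iter n0 P v], while connectedness spreads the gap between [w] and [u] at the one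
    coordinate [y] to every coordinate [z]. *)
Lemma iter_upper_contraction u v c y z :
  0 <= c -> (forall x, u 0 x - v 0 x <= c) ->
  iter n0 P u 0 z - iter n0 P v 0 z <= c - eps0 * (c - (u 0 y - v 0 y)).
Proof.
move=> c0 uvc; set w := v + c *: vone.
have wE x : w 0 x = v 0 x + c by rewrite !mxE mulr1.
have Pw : iter n0 P w 0 z <= iter n0 P v 0 z + c.
  rewrite -lerBlDl; apply: le_trans (_ : `|w - v| <= c); last first.
    apply: normr_row_le => // x; rewrite !mxE mulr1 addrAC subrr add0r.
    by rewrite ger0_norm.
  apply: le_trans (iter_non_expansive n0 w v).
  by have := entry_le_normr _ _ (iter n0 P w - iter n0 P v) z; rewrite !mxE.
(* Connectedness needs a strictly positive gap; when the gap at [y] is zero, so is the gain, and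
   monotonicity suffices. *)
have [cy|cy] := ltP (u 0 y - v 0 y) c.
  have uw : vle (u + (c - (u 0 y - v 0 y)) *: vind y) w.
    move=> x; rewrite wE !mxE eqxx /=; have [->|xy] := eqVneq x y.
      by rewrite mulr1; lra.
    by rewrite mulr0; have := uvc x; lra.
  have cy' : 0 < c - (u 0 y - v 0 y) by rewrite subr_gt0.
  by have := P_conn y _ _ _ cy' uw z; rewrite !mxE mulr1; lra.
have -> : u 0 y - v 0 y = c by apply/le_anti; rewrite uvc cy.
have /(iter_monotone n0)/(_ z) : vle u w.
  by move=> x; rewrite wE; have := uvc x; lra.
by rewrite subrr mulr0; lra.
Qed.

(** The one-sided bound is used twice with [c] the norm of [u - v]: for [u - v] with the gap at [y],
    and for [v - u] with the gap at [x]. Either gap is at least the difference of the entries of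
    [u - v] at [x] and [y]. *)
Lemma normr_iter_drop u v x y :
  eps0 * ((u 0 x - v 0 x) - (u 0 y - v 0 y)) <=
  `|u - v| - `|iter n0 P u - iter n0 P v|.
Proof.
set D := u - v; set osc := (X in eps0 * X).
have DE z : u 0 z - v 0 z = D 0 z by rewrite !mxE.
have le_D z : u 0 z - v 0 z <= `|D| by rewrite DE entry_le_normr.
have ge_D z : v 0 z - u 0 z <= `|D|.
  have := entry_le_normr _ _ (v - u) z.
  by rewrite distrC !mxE.
have up z : iter n0 P u 0 z - iter n0 P v 0 z <= `|D| - eps0 * osc.
  apply: le_trans (iter_upper_contraction u v `|D| y z _ le_D) _ => //.
  by rewrite lerD2l lerN2 ler_pM2l // /osc lerD2r.
have dn z : iter n0 P v 0 z - iter n0 P u 0 z <= `|D| - eps0 * osc.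
  apply: le_trans (iter_upper_contraction v u `|D| x z _ ge_D) _ => //.
  by rewrite lerD2l lerN2 ler_pM2l // /osc; have := ge_D y; lra.
rewrite lerBrDr addrC -lerBrDr; apply: normr_row_le.
  (* The left sides of [up x] and [dn x] are opposite, so adding the two shows that the common bound
     is nonnegative. *)
  by have := up x; have := dn x; lra.
move=> z; rewrite !mxE ler_norml; apply/andP; split; last exact: up.
by have := dn z; lra.
Qed.

Variable x0 : 'I_N.
Local Notation F := (normalized_orbit P x0).

Lemma normalized_orbit_dist u v n :
  eps0 * `|F u n - F v n| <=
  `|iter n P u - iter n P v| - `|iter (n + n0) P u - iter (n + n0) P v|.
Proof.
rewrite addnC !iterD mulrC -ler_pdivlMr //; apply: normr_row_le.
  apply: divr_ge0 (ltW eps0_gt0); rewrite subr_ge0; exact: iter_non_expansive.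
move=> x; rewrite ler_pdivlMr // mulrC !mxE !mulr1.
(* After normalization, entry [x] is the difference of the entries of [iter n P u - iter n P v] at
   [x] and [x0]; the two orders of [x], [x0] bound both signs. *)
have := normr_iter_drop (iter n P u) (iter n P v) x x0.
have := normr_iter_drop (iter n P u) (iter n P v) x0 x.
move=> h1 h2; rewrite -[in leLHS](gtr0_norm eps0_gt0) -normrM.
by rewrite ler_norml; apply/andP; split; lra.
Qed.

(** [c] acts as the tail of a convergent series: it dominates each distance and also, by
    telescoping, sums of consecutive ones. *)
Lemma normalized_orbit_summable u v : exists c : nat -> R,
  [/\ forall n, 0 <= c n, c n @[n --> \oo] --> 0 &
      forall n, `|F u n - F v n| <= c n - c n.+1].
Proof.
pose a n := `|iter n P u - iter n P v|.
(* Summing n0 consecutive norms turns a drop over n0 steps into a drop over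
   one step: b n - b n.+1 = a n - a (n + n0). *)
pose b n := \sum_(j < n0) a (n + j)%N.
have bB n : b n - b n.+1 = a n - a (n + n0)%N.
  rewrite /b; case: n0 n0_gt0 => // k _; rewrite big_ord_recl big_ord_recr /=.
  rewrite addn0 addSnnS (eq_bigr (fun j : 'I_k => a (n.+1 + j)%N)); first lra.
  by move=> j _; rewrite addSnnS.
have b_drop n : eps0 * `|F u n - F v n| <= b n - b n.+1.
  by rewrite bB; exact: normalized_orbit_dist.
have b_decr : nonincreasing_seq b.
  apply/nonincreasing_seqP => n; rewrite -subr_ge0.
  by apply: le_trans (b_drop n); rewrite mulr_ge0 // ltW.
have b_cvg : cvgn b.
  apply: nonincreasing_is_cvgn => //; exists 0 => _ [n _ <-].
  by apply: sumr_ge0 => j _; exact: normr_ge0.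
(* Subtracting the limit of the nonincreasing [b] gives a nonnegative sequence tending to 0 with the
   same increments. *)
exists (fun n => (b n - limn b) / eps0); split => [n||n].
- by rewrite divr_ge0 ?(ltW eps0_gt0) // subr_ge0 nonincreasing_cvgn_ge.
- rewrite -[X in _ --> X](mul0r eps0^-1) -(subrr (limn b)).
  by apply: cvgMl; apply: cvgB => //; exact: cvg_cst.
- by rewrite -mulrBl ler_pdivlMr // mulrC; have := b_drop n; lra.
Qed.

End Connected.
End Orbits.

Lemma norm_cvg0_le (R : realType) (V : normedModType R) (h : nat -> V) (g : V)
    (c : nat -> R) :
  c n @[n --> \oo] --> 0 -> (forall n, `|h n - g| <= c n) ->
  h n @[n --> \oo] --> g.
Proof.
move=> c0 hc; apply/cvgrPdist_le => e e0.
move/cvgrPdist_le: c0 => /(_ e e0); apply: filterS => n.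
rewrite sub0r normrN distrC => cn.
exact: le_trans (hc n) (le_trans (ler_norm _) cn).
Qed.

Lemma accumulation_cvg (R : realType) (N : nat) (h : nat -> 'rV[R]_N)
    (g : 'rV[R]_N) (c : nat -> R) :
  (forall n, 0 <= c n) -> c n @[n --> \oo] --> 0 ->
  (forall n, `|h n - h n.+1| <= c n - c n.+1) ->
  accumulation_point h g -> h n @[n --> \oo] --> g.
Proof.
move=> c_ge0 c0 hc h_acc; apply: norm_cvg0_le c0 _ => n.
have tail k : `|h n - h (n + k)%N| <= c n - c (n + k)%N.
  elim: k => [|k IHk]; first by rewrite addn0 !subrr normr0.
  rewrite addnS; apply: le_trans (ler_distD (h (n + k)%N) _ _) _.
  by have := hc (n + k)%N; lra.
(* A later term [h k] close to [g] transfers the tail bound to [g], since [c k] is nonnegative. *)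
apply/ler_addgt0Pr => e e0; have [k nk hk] := h_acc n e e0.
apply: le_trans (ler_distD (h k) _ _) _; apply: lerD; last exact: ltW.
have := tail (k - n)%N; rewrite subnKC 1?ltnW // => /le_trans; apply.
by rewrite lerBlDr lerDl.
Qed.

Theorem theorem3 (R : realType) (N : nat) (f : 'rV[R]_N)
    (P : 'rV[R]_N -> 'rV[R]_N)
    (P_mono : monotone_map P)
    (P_nonexp : non_expansive P)
    (P_conn : uniformly_connected P)
    (x0 : 'I_N) (g : 'rV[R]_N)
    (g_acc : accumulation_point (normalized_orbit P x0 f) g) :
  normalized_orbit P x0 f n @[n --> \oo] --> g /\
  (forall f' : 'rV[R]_N,
    (exists g' : 'rV[R]_N, accumulation_point (normalized_orbit P x0 f') g') ->
    normalized_orbit P x0 f' n @[n --> \oo] --> g).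
Proof.
have [n0 [eps0 [n0_gt0 eps0_gt0 conn]]] := P_conn.
have summable :=
  normalized_orbit_summable R N P P_mono P_nonexp n0 eps0 n0_gt0 eps0_gt0 conn x0.
have f_cvg : normalized_orbit P x0 f n @[n --> \oo] --> g.
  (* The orbit of [P f] is that of [f] advanced by one step, so this bounds consecutive terms. *)
  have [c [c_ge0 c0 hc]] := summable f (P f).
  apply: (accumulation_cvg _ _ _ _ c) g_acc => // n.
  by have := hc n; rewrite /normalized_orbit -iterSr.
split=> // f' _; have [c [c_ge0 c0 hc]] := summable f' f.
have diff_cvg : normalized_orbit P x0 f' n - normalized_orbit P x0 f n
    @[n --> \oo] --> (0 : 'rV[R]_N).
  apply: (norm_cvg0_le _ _ _ _ c) => // n; rewrite subr0.
  by apply: le_trans (hc n) _; rewrite lerBlDr lerDl.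
have -> : normalized_orbit P x0 f' = (fun n =>
    normalized_orbit P x0 f' n - normalized_orbit P x0 f n +
    normalized_orbit P x0 f n) by apply/funext => n; rewrite subrK.
by rewrite -[g]add0r; exact: cvgD.
Qed.
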